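(* Let $d_x,d_y\in\mathbb{N}$, let $L>0$ and $\mu\ge 0$, and let $f:\mathbb{R}^{d_x}\times\mathbb{R}^{d_y}\to\mathbb{R}$ be an $L$-smooth, $\mu$-strongly-convex-strongly-concave function with saddle point $z^*=(x^*,y^* )$. For any initialization $z_0=(x_0,y_0)\in\mathbb{R}^{d_x}\times\mathbb{R}^{d_y}$ and any number of iterations $T\in\mathbb{N}$, the iterates $z_t=(x_t,y_t)$ of alternating gradient-descent-ascent with momentum, $$x_{t+1}=x_t-\eta\nabla_x f(x_t,y_t)+\beta(x_t-x_{t-1}),\qquad y_{t+1}=y_t+\eta\nabla_y f(x_{t+1},y_t)+\beta(y_t-y_{t-1})\qquad (t\ge 0),$$ with $x_{-1}:=x_0$, $y_{-1}:=y_0$, stepsize $\eta=\frac{1}{5L}$ and negative momentum $\beta=-\frac12$, satisfy $$\|z_T-z^*\|^2\le 6\,(1-\eta\mu)^T\,\|z_0-z^*\|^2.$$ In particular, if $\mu>0$ and $\kappa:=L/\mu$ denotes the condition number, then $\|z_T-z^*\|^2\le\varepsilon\|z_0-z^*\|^2$ after $T=\mathcal{O}(\kappa\log\frac1\varepsilon)$ iterations; that is, there is a universal constant $C>0$ (independent of $f,L,\mu,d_x,d_y,z_0,\varepsilon$) such that for every $\varepsilon\in(0,\frac12]$ and every integer $T\ge C\kappa\log\frac1\varepsilon$ one has $\|z_T-z^*\|^2\le\varepsilon\|z_0-z^*\|^2$.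
   Context: All norms are Euclidean. A differentiable function $f$ is $L$-smooth if $\|\nabla f(a)-\nabla f(b)\|\le L\|a-b\|$ for all $a,b$ (with $\nabla f=(\nabla_x f,\nabla_y f)$ the full gradient on $\mathbb{R}^{d_x}\times\mathbb{R}^{d_y}$). For $\mu\ge0$, a function $g$ is $\mu$-strongly convex if $b\mapsto g(b)-\frac{\mu}{2}\|b\|^2$ is convex, and $\mu$-strongly concave if $-g$ is $\mu$-strongly convex. $f$ is $\mu$-strongly-convex-strongly-concave if $f(\cdot,y)$ is $\mu$-strongly convex for every $y$ and $f(x,\cdot)$ is $\mu$-strongly concave for every $x$. A saddle point $(x^*,y^* )$ is a point with $f(x^*,y)\le f(x^*,y^* )\le f(x,y^* )$ for all $x,y$; equivalently here, $\nabla f(x^*,y^* )=0$. Note that the $y$-update uses the already updated $x_{t+1}$. *)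

(* Defs.v *)
From mathcomp Require Import all_boot all_order all_algebra.
From mathcomp Require Import all_classical all_reals all_analysis.

Set Implicit Arguments.
Unset Strict Implicit.
Unset Printing Implicit Defensive.

Import Order.TTheory GRing.Theory Num.Theory.
Import numFieldNormedType.Exports.

Local Open Scope classical_set_scope.
Local Open Scope ring_scope.

(* The norm carried by the normedModType instances on ['rV[R]_n] and on products
   is the sup norm, so the Euclidean norms are defined here. The topologies
   coincide, hence so do [differentiable] and ['D_v] for either norm. *)
Definition enorm {R : realType} {n : nat} (v : 'rV[R]_n) : R :=
  Num.sqrt (\sum_(i < n) v ord0 i ^+ 2).

Definition penorm {R : realType} {dx dy : nat}
    (z : 'rV[R]_dx * 'rV[R]_dy) : R :=
  Num.sqrt (enorm z.1 ^+ 2 + enorm z.2 ^+ 2).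

Section MinMax.
Context {R : realType} {dx dy : nat}.
Implicit Types (f : 'rV[R]_dx * 'rV[R]_dy -> R) (z : 'rV[R]_dx * 'rV[R]_dy).

Definition gradx f z : 'rV[R]_dx :=
  \row_(i < dx) 'D_((delta_mx ord0 i : 'rV[R]_dx), (0 : 'rV[R]_dy)) f z.

Definition grady f z : 'rV[R]_dy :=
  \row_(j < dy) 'D_((0 : 'rV[R]_dx), (delta_mx ord0 j : 'rV[R]_dy)) f z.

Definition grad f z : 'rV[R]_dx * 'rV[R]_dy := (gradx f z, grady f z).

Definition smooth (L : R) f : Prop :=
  (forall z, differentiable f z) /\
  (forall a b, penorm (grad f a - grad f b) <= L * penorm (a - b)).

Definition strongly_convex {n : nat} (mu : R) (g : 'rV[R]_n -> R) : Prop :=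
  convex_function [set: convex_lmodType 'rV[R]_n]
    (fun b => g b - mu / 2 * enorm b ^+ 2).

Definition strongly_concave {n : nat} (mu : R) (g : 'rV[R]_n -> R) : Prop :=
  strongly_convex mu (fun b => - g b).

Definition strongly_convex_strongly_concave (mu : R) f : Prop :=
  (forall y, strongly_convex mu (fun x => f (x, y))) /\
  (forall x, strongly_concave mu (fun y => f (x, y))).

Definition saddle_point f (zs : 'rV[R]_dx * 'rV[R]_dy) : Prop :=
  forall x y, f (zs.1, y) <= f zs /\ f zs <= f (x, zs.2).

(* [z t.-1] is z_{t-1} for t > 0; since [0.-1 = 0], at t = 0 it is z_0, which
   is the convention z_{-1} := z_0. *)
Definition alt_gda_momentum f (eta beta : R)
    (z : nat -> 'rV[R]_dx * 'rV[R]_dy) : Prop :=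
  forall t : nat,
    (z t.+1).1 = (z t).1 - eta *: gradx f ((z t).1, (z t).2)
                   + beta *: ((z t).1 - (z t.-1).1) /\
    (z t.+1).2 = (z t).2 + eta *: grady f ((z t.+1).1, (z t).2)
                   + beta *: ((z t).2 - (z t.-1).2).

End MinMax.

(* Main.v *)
Require Import Defs.
From mathcomp Require Import all_boot all_order all_algebra.
From mathcomp Require Import all_classical all_reals all_analysis.
From mathcomp Require Import ring lra.
Import Order.TTheory GRing.Theory Num.Theory.
Import numFieldNormedType.Exports.
Local Open Scope ring_scope.

(** With momentum -1/2 the point p_t = x_t - (x_t - x_{t-1}) / 3 follows plain
    gradient descent, p_{t+1} = p_t - (2/3) eta g_t with g_t the x-gradient at
    z_t = (x_t, y_t); likewise for y, with h_t the y-gradient at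
    w_t = (x_{t+1}, y_t).  So x_t is p_t shifted by a multiple of recent
    gradients, a look-ahead of the kind that stabilises gradient
    descent-ascent.  A Lyapunov function makes this quantitative.

    Put eta = 1/(5L), tau = eta mu, and write F(z) = (f(z) - f(zs)) / L,
    zs = (xs, ys).  The function ([energy], up to the factor L) is
      |p_t - xs|^2 + |q_t - ys|^2 + Q_t - F(z_t) / 9,
    q_t being the analogue of p_t for y and Q_t a quadratic form in the last
    two displacements.  To show that it shrinks by the factor 1 - tau, add up:
    - convexity in x from z_t to (xs, y_t), concavity in y from w_t to
      (x_{t+1}, ys), and quadratic growth of f around the saddle point, all with
      weight 4/15 = 2 (2/3) (1/5), the weight of <g_t, x_t - xs> in the
      change of |p_t - xs|^2 when L = 1.  The function values left over are
      4/15 (F(w_t) - F(z_t));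
    - 7/45 of this difference is bounded by the descent inequality along the
      x-step; for the remaining 1/9, F(w_t) - F(z_t) is written as
      F(z_{t+1}) - F(z_t), which the term - F(z_t) / 9 of the energy absorbs,
      minus F(z_{t+1}) - F(w_t), bounded by the descent inequality along the
      y-step.  Thus x- and y-steps end up in nearly symmetric roles.
    What remains is a quadratic form in x_t - xs and the last displacements
    ([resid_x]) plus one in the y-variables ([resid_y]); see [energy_step].
    These would not quite be negative: an oscillation x_{t+1} - x_t =
    - (x_t - x_{t-1}) is not damped.  But such an oscillation requires
    gradients that change much faster than L allows, so adding multiples of the
    Lipschitz bounds on g_t - g_{t-1} and h_t - h_{t-1} makes both forms
    negative ([resid_x_le], [resid_y_le], [energy_decrease]).  The very first
    step has no preceding gradient, but no preceding displacement either.

    Since |F(z)| <= |z - zs|^2 / 2, the energy (divided by L) lies above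
    (19/108) |z_t - zs|^2, and at time 0 below (19/18) |z_0 - zs|^2; the
    quotient of the two constants is 6. *)

(** * Euclidean inner product *)

Definition dot {R : realType} {n : nat} (u v : 'rV[R]_n) : R :=
  \sum_(i < n) u ord0 i * v ord0 i.

Notation sq u := (dot u u).

Section Dot.
Context {R : realType} {n : nat}.
Implicit Types (u v w : 'rV[R]_n) (k : R).

Lemma dotC u v : dot u v = dot v u.
Proof. by apply: eq_bigr => i _; rewrite mulrC. Qed.

Lemma dotDl u v w : dot (u + v) w = dot u w + dot v w.
Proof. by rewrite -big_split; apply: eq_bigr => i _; rewrite mxE mulrDl. Qed.

Lemma dotZl k u w : dot (k *: u) w = k * dot u w.
Proof. by rewrite mulr_sumr; apply: eq_bigr => i _; rewrite mxE mulrA. Qed.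

Lemma dotNl u w : dot (- u) w = - dot u w.
Proof. by rewrite -scaleN1r dotZl mulN1r. Qed.

Lemma dotBl u v w : dot (u - v) w = dot u w - dot v w.
Proof. by rewrite dotDl dotNl. Qed.

Lemma dotDr u v w : dot w (u + v) = dot w u + dot w v.
Proof. by rewrite dotC dotDl !(dotC w). Qed.

Lemma dotZr k u w : dot w (k *: u) = k * dot w u.
Proof. by rewrite dotC dotZl (dotC w). Qed.

Lemma dotNr u w : dot w (- u) = - dot w u.
Proof. by rewrite dotC dotNl (dotC w). Qed.

Lemma dotBr u v w : dot w (u - v) = dot w u - dot w v.
Proof. by rewrite dotDr dotNr. Qed.

Lemma dot0l w : dot 0 w = 0.
Proof. by rewrite -(scale0r 0) dotZl mul0r. Qed.

Lemma dot0r w : dot w 0 = 0.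
Proof. by rewrite dotC dot0l. Qed.

Lemma sq_ge0 u : 0 <= sq u.
Proof. by apply: sumr_ge0 => i _; rewrite -expr2 sqr_ge0. Qed.

Lemma sq_le0 u : sq u <= 0 -> u = 0.
Proof.
move=> u0; apply/rowP => i; rewrite mxE.
have /eqP : sq u == 0 by rewrite eq_le u0 sq_ge0.
move/eqP; rewrite psumr_eq0 => [/allP/(_ i)|j _]; last by rewrite -expr2 sqr_ge0.
by rewrite mem_index_enum mulf_eq0 orbb => /(_ isT)/eqP.
Qed.

Lemma dot_young k u v : 2 * k * dot u v <= sq u + k ^+ 2 * sq v.
Proof.
have := sq_ge0 (u - k *: v); rewrite !(dotBl, dotBr, dotZl, dotZr) (dotC v u).
lra.
Qed.

Lemma enorm_sq u : enorm u ^+ 2 = sq u.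
Proof.
rewrite /enorm sqr_sqrtr; last by apply: sumr_ge0 => i _; rewrite sqr_ge0.
by apply: eq_bigr => i _; rewrite expr2.
Qed.

End Dot.

Definition dotE := (@dotDl, @dotBl, @dotZl, @dotNl, @dotDr, @dotBr, @dotZr, @dotNr).

Lemma penorm_sq {R : realType} {dx dy : nat} (z : 'rV[R]_dx * 'rV[R]_dy) :
  penorm z ^+ 2 = sq z.1 + sq z.2.
Proof. by rewrite /penorm sqr_sqrtr ?enorm_sq// addr_ge0 ?sq_ge0. Qed.

(** * One-dimensional calculus and first-order strong convexity *)

Section Calculus.
Context {R : realType}.

(** Subtracting [dphi 0 * s + K / 2 * s ^+ 2] leaves a function whose
    derivative is nonpositive on positive reals; the mean value theorem on
    the unit interval concludes. *)
Lemma le_quadratic_of_deriv (phi dphi : R -> R) (K : R) :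
  (forall s : R, is_derive s 1 phi (dphi s)) ->
  (forall s, 0 < s -> dphi s - dphi 0 <= K * s) ->
  phi 1 <= phi 0 + dphi 0 + K / 2.
Proof.
move=> dphiE Kle.
pose psi := phi - (fun s => dphi 0 * s + K / 2 * s ^+ 2).
have dpsi (s : R) : is_derive s 1 psi (dphi s - (dphi 0 + K * s)).
  rewrite /psi; apply: is_deriveB.
  by apply: is_derive_eq; rewrite /GRing.scale/=; lra.
have [|c c01 E] := @MVT R psi (fun s => dphi s - (dphi 0 + K * s)) 0 1 ltr01
  (fun s _ => dpsi s).
  apply: derivable_within_continuous => s _.
  by have [] := dpsi s.
move: c01; rewrite in_itv/= => /andP[c0 _].
have := Kle _ c0.
move: E; rewrite /psi !fctE. lra.
Qed.

(** This replaces letting [t] tend to 0 when an inequality holds up to an error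
    of order [t]. *)
Lemma le_of_small_slope (d k m : R) :
  (forall t, 0 < t -> t <= 1 -> d <= k + t * m) -> d <= k.
Proof.
move=> H; rewrite leNgt; apply/negP => kd.
have m0 : 0 < m.
  have := H 1 ltr01 (lexx _); lra.
have p0 : 0 < (d - k) + 2 * m by lra.
have := H ((d - k) / ((d - k) + 2 * m)).
rewrite divr_gt0 ?ler_pdivrMr ?mul1r// ?subr_gt0// => /(_ isT).
have -> : d - k <= d - k + 2 * m by lra.
move=> /(_ isT); rewrite mulrAC -lerBlDl ler_pdivlMr //; nra.
Qed.

Lemma strongly_convex_segment n (mu t : R) (g : 'rV[R]_n -> R) u v :
  strongly_convex mu g -> 0 <= t -> t <= 1 ->
  g (u + t *: v) <=
    (1 - t) * g u + t * g (u + v) - mu / 2 * (t * (1 - t)) * sq v.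
Proof.
move=> cg t0 t1.
have := cg (Itv01 t0 t1) (u + v) u; rewrite !inE => /(_ Logic.I Logic.I).
rewrite convRE /conv/= /unstable.onem !enorm_sq.
have -> : t *: (u + v) + (1 - t) *: u = u + t *: v.
  by rewrite scalerDr scalerBl scale1r addrC addrA subrK.
rewrite !dotE (dotC v u); lra.
Qed.

(** The slope [d] of [g] along [v] enters only through a quadratic lower bound
    with an arbitrary error constant [m], which is what smoothness provides;
    the error is of second order in [t] and vanishes in comparison with the
    convexity inequality on the segment, divided by [t]. *)
Lemma strongly_convex_first_order n (mu d m : R) (g : 'rV[R]_n -> R) u v :
  strongly_convex mu g ->
  (forall t, 0 < t -> t <= 1 -> g u + t * d - t ^+ 2 * m <= g (u + t *: v)) ->
  g u + d + mu / 2 * sq v <= g (u + v).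
Proof.
move=> cg lg.
suff : d <= g (u + v) - g u - mu / 2 * sq v by lra.
apply: (@le_of_small_slope _ _ (mu / 2 * sq v + m)) => t t0 t1.
have := @strongly_convex_segment n mu t g u v cg (ltW t0) t1.
have := lg _ t0 t1 => /le_trans /[apply] H.
rewrite -(ler_pM2l t0); nra.
Qed.
End Calculus.

(** * Descent inequalities for smooth functions *)

Section Smooth.
Context {R : realType} {dx dy : nat}.
Variables (L : R) (f : 'rV[R]_dx * 'rV[R]_dy -> R).
Hypotheses (L0 : 0 < L) (fL : smooth L f).
Implicit Types (a b v z : 'rV[R]_dx * 'rV[R]_dy).

Definition slope z v := dot (gradx f z) v.1 + dot (grady f z) v.2.

Lemma derive_slope z v : 'D_v f z = slope z v.
Proof.
have df := fL.1 z.
case: v => v1 v2; rewrite /slope/=.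
have -> : (v1, v2) = \sum_i v1 ord0 i *: (delta_mx ord0 i : 'rV[R]_dx, 0 : 'rV[R]_dy)
   + \sum_j v2 ord0 j *: (0 : 'rV[R]_dx, delta_mx ord0 j : 'rV[R]_dy).
  rewrite -[in LHS](addr0 v1) -[in LHS](add0r v2) -[LHS]/((v1, 0) + (0, v2)).
  congr (_ + _).
    rewrite [v1 in LHS]row_sum_delta.
    apply: (big_rec2 (fun x y => (x, 0) = y)) => // i u1 u2 _ <-.
    by congr pair; rewrite /= ?scaler0 ?addr0.
  rewrite [v2 in LHS]row_sum_delta.
  apply: (big_rec2 (fun x y => (0, x) = y)) => // i u1 u2 _ <-.
  by congr pair; rewrite /= ?scaler0 ?addr0.
rewrite deriveE // linearD !linear_sum/=; congr (_ + _).
  by apply: eq_bigr => i _; rewrite linearZ/= mxE deriveE// mulrC.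
by apply: eq_bigr => i _; rewrite linearZ/= mxE deriveE// mulrC.
Qed.

Lemma derive_line a v (s : R) :
  is_derive s 1 (fun s : R => f (a + s *: v)) (slope (a + s *: v) v).
Proof.
have E : (fun h : R => h^-1 *: (f (a + (h *: 1 + s) *: v) - f (a + s *: v))) =
         (fun h : R => h^-1 *: (f (h *: v + (a + s *: v)) - f (a + s *: v))).
  by apply/funext => h; rewrite [h *: 1]mulr1 scalerDl addrCA addrA.
apply: DeriveDef; first by rewrite /derivable E; exact/diff_derivable/fL.1.
by rewrite /derive E; exact: derive_slope.
Qed.

Lemma grad_lipschitz a b :
  sq (gradx f a - gradx f b) + sq (grady f a - grady f b) <=
  L ^+ 2 * (sq (a.1 - b.1) + sq (a.2 - b.2)).
Proof.
have := fL.2 a b.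
by rewrite -!(penorm_sq (_, _)) -exprMn ler_sqr ?nnegrE ?mulr_ge0 ?(ltW L0) ?sqrtr_ge0.
Qed.

(** The Cauchy-Schwarz inequality is used in the form
    2 L s <u, v> <= |u|^2 + (L s)^2 |v|^2 for the difference u of the two
    gradients, which satisfies |u| <= L s |v|. *)
Lemma slope_lipschitz a v s : 0 < s ->
  `|slope (a + s *: v) v - slope a v| <= L * (sq v.1 + sq v.2) * s.
Proof.
move=> s0; rewrite /slope.
have := grad_lipschitz (a + s *: v) a.
rewrite /= !(addrC _ (s *: _)) !addrK.
rewrite !(dotZl s) !(dotZr s).
set u1 := _ - _; set u2 := _ - _ => H.
rewrite opprD addrACA -!dotBl -/u1 -/u2.
have := dot_young (L * s) u1 v.1; have := dot_young (L * s) u2 v.2.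
have := dot_young (- (L * s)) u1 v.1; have := dot_young (- (L * s)) u2 v.2.
have Ls : 0 < 2 * (L * s) by rewrite !mulr_gt0.
move: (dot u1 _) (dot u2 _) (sq u1) (sq u2) (sq v.1) (sq v.2) H Ls.
move=> d1 d2 p1 p2 q1 q2 H Ls Y1 Y2 Y3 Y4.
rewrite ler_norml; apply/andP; split; rewrite -(ler_pM2l Ls); lra.
Qed.

Lemma descent_le a v : f (a + v) <= f a + slope a v + L / 2 * (sq v.1 + sq v.2).
Proof.
have := @le_quadratic_of_deriv R _ _ (L * (sq v.1 + sq v.2)) (derive_line a v).
rewrite scale0r addr0 scale1r mulrAC; apply => s s0.
exact: le_trans (ler_norm _) (slope_lipschitz _ _ _ s0).
Qed.

Lemma descent_ge a v : f a + slope a v - L / 2 * (sq v.1 + sq v.2) <= f (a + v).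
Proof.
have dN (s : R) : is_derive s 1 (- (fun s : R => f (a + s *: v))) (- slope (a + s *: v) v).
  by apply: is_deriveN; exact: derive_line.
have := @le_quadratic_of_deriv R _ _ (L * (sq v.1 + sq v.2)) dN.
rewrite !fctE scale0r addr0 scale1r => H.
suff: - f (a + v) <= - f a - slope a v + L / 2 * (sq v.1 + sq v.2) by lra.
rewrite mulrAC; apply: H => s s0.
rewrite opprK addrC; apply: le_trans (slope_lipschitz a v s s0).
by rewrite distrC ler_norm.
Qed.
End Smooth.

(** * The quadratic forms of the Lyapunov argument *)

Section Blocks.
Context {R : realType} {n : nat}.
Implicit Types (tau : R) (x y a b c : 'rV[R]_n).

(** The part of the energy that concerns one of the two players: [x] is the
    error, [b] the last displacement and [c] the one before.  The coefficients
    of the form in [b] and [c] were chosen numerically so that the residual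
    forms below become negative and [pot] stays bounded below by a multiple
    of [sq x]. *)
Definition pot x b c : R :=
  sq (x - 3^-1 *: b) + (5 * sq b - 6 * dot b c + 7 * sq c) / 100.

(** What is left, for the first player, of the change of energy when [a] is
    the new displacement.  For L = 1 the gradient g_t is -5 (a + b/2), which
    turns the weight 4/15 of <g_t, x> into 4/3 and the descent inequality
    along the step into the last term; mu / 2 times the weight 4/15 is
    2/3 tau.  The term tau / 18 pays for - tau F(z_t) / 9. *)
Definition resid_x tau x a b c : R :=
  pot (x + a) a b - (1 - tau) * pot x b c + tau / 18 * sq x
  - 4 / 3 * dot (a + 2^-1 *: b) x - 2 / 3 * tau * (sq x + sq (x + a))
  - 7 / 45 * (5 * dot (a + 2^-1 *: b) a - sq a / 2).

(** The analogue of [resid_x] for the second player, where h_t is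
    5 (a + b/2).  Both strong concavity terms involve the old point [y],
    since y_t is the second coordinate of z_t and of w_t alike. *)
Definition resid_y tau y a b c : R :=
  pot (y + a) a b - (1 - tau) * pot y b c + tau / 18 * sq y
  - 4 / 3 * dot (a + 2^-1 *: b) y - 2 / 3 * tau * (sq y + sq y)
  - 1 / 9 * (5 * dot (a + 2^-1 *: b) a - sq a / 2).

(** The residual forms are affine in [tau], so that their sign has to be
    checked at the two extreme values only. *)
Lemma affine_le tau (r : R -> R) (k : R) : 0 <= tau -> tau <= 5^-1 ->
  r tau = (1 - 5 * tau) * r 0 + 5 * tau * r 5^-1 ->
  r 0 <= k -> r 5^-1 <= k -> r tau <= k.
Proof.
move=> t0 t1 -> r0 r1.
have -> : k = (1 - 5 * tau) * k + 5 * tau * k by ring.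
by apply: lerD; apply: ler_wpM2l => //; lra.
Qed.

(** Both orders of a product must become the same atom for [lra]. *)
Ltac gram x a b c :=
  rewrite !dotE ?(dotC a x) ?(dotC b x) ?(dotC c x)
    ?(dotC b a) ?(dotC c a) ?(dotC c b).

(** The first term on the right is, for L = 1 and up to the factor 25, the
    square of g_t - g_{t-1}: the Lipschitz bound on it enters with weight
    1/150.  The two subtracted squares come from that bound and from the one
    on h_t - h_{t-1}, of weight 1/25.

    At each extreme value of [tau] the difference of the two sides is a
    negative definite form (in the variables that occur), hence a combination
    of the squares supplied to [lra].  They come from completing squares in the
    order x, a, b, c, where the last quotient is rounded to a simple fraction. *)
Lemma resid_x_le tau x a b c : 0 <= tau -> tau <= 5^-1 ->
  resid_x tau x a b c <=
  6^-1 * sq (a - 2^-1 *: b - 2^-1 *: c) - 150^-1 * sq b - 25^-1 * sq a.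
Proof.
move=> t0 t1; apply: (@affine_le tau (fun t => resid_x t x a b c)) => //.
- by rewrite /resid_x; field.
- rewrite /resid_x /pot; gram x a b c.
  have := sq_ge0 (299 *: a + 127 *: b - 75 *: c).
  have := sq_ge0 (4 *: b + 3 *: c).
  have := sq_ge0 b; have := sq_ge0 c.
  gram x a b c; lra.
- rewrite /resid_x /pot; gram x a b c.
  have := sq_ge0 (5 *: x + 12 *: a + 6 *: b).
  have := sq_ge0 (131 *: a - 17 *: b - 75 *: c).
  have := sq_ge0 (5 *: b + 3 *: c).
  have := sq_ge0 b; have := sq_ge0 c.
  gram x a b c; lra.
Qed.

Lemma resid_y_le tau y a b c : 0 <= tau -> tau <= 5^-1 ->
  resid_y tau y a b c <=
  sq (a - 2^-1 *: b - 2^-1 *: c) - (150^-1 + 25^-1) * sq b.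
Proof.
move=> t0 t1; apply: (@affine_le tau (fun t => resid_y t y a b c)) => //.
- by rewrite /resid_y; field.
- rewrite /resid_y /pot; gram y a b c.
  have := sq_ge0 (905 *: a - 298 *: b - 450 *: c).
  have := sq_ge0 (10 *: b + 3 *: c).
  have := sq_ge0 b; have := sq_ge0 c.
  gram y a b c; lra.
- rewrite /resid_y /pot; gram y a b c.
  have := sq_ge0 (5 *: y + 6 *: b).
  have := sq_ge0 (905 *: a - 298 *: b - 450 *: c).
  have := sq_ge0 (7 *: b + 6 *: c).
  have := sq_ge0 b; have := sq_ge0 c.
  gram y a b c; lra.
Qed.

(** At the first step the earlier displacements vanish and the residuals are
    nonpositive without any Lipschitz bound. *)
Lemma resid_x_first tau x a : 0 <= tau -> tau <= 5^-1 ->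
  resid_x tau x a 0 0 <= 0.
Proof.
move=> t0 t1; apply: (@affine_le tau (fun t => resid_x t x a 0 0)) => //.
- by rewrite /resid_x; field.
- rewrite /resid_x /pot; gram x a a a; rewrite !(dot0l, dot0r).
  have := sq_ge0 a; lra.
- rewrite /resid_x /pot; gram x a a a; rewrite !(dot0l, dot0r).
  have := sq_ge0 (5 *: x + 12 *: a); have := sq_ge0 a.
  gram x a a a; lra.
Qed.

Lemma resid_y_first tau y a : 0 <= tau -> tau <= 5^-1 ->
  resid_y tau y a 0 0 <= 0.
Proof.
move=> t0 t1; apply: (@affine_le tau (fun t => resid_y t y a 0 0)) => //.
- by rewrite /resid_y; field.
- rewrite /resid_y /pot; gram y a a a; rewrite !(dot0l, dot0r).
  have := sq_ge0 a; lra.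
- rewrite /resid_y /pot; gram y a a a; rewrite !(dot0l, dot0r).
  have := sq_ge0 y; have := sq_ge0 a; lra.
Qed.

(** The constant is 19/108 + 1/18: the second part absorbs the function value in
    the energy, and the first is a sixth of 19/18 = 1 + 1/18, the largest value
    of the initial energy relative to the initial error. *)
Lemma pot_ge x b c : 25 / 108 * sq x <= pot x b c.
Proof.
rewrite /pot; gram x b b c.
have := sq_ge0 (83 *: x - 36 *: b); have := sq_ge0 (b - 2 *: c).
have := sq_ge0 b; have := sq_ge0 c; gram x b b c.
lra.
Qed.

End Blocks.

(** * The saddle point *)

Section Saddle.
Context {R : realType} {dx dy : nat}.
Variables (L mu : R) (f : 'rV[R]_dx * 'rV[R]_dy -> R).
Variable (zs : 'rV[R]_dx * 'rV[R]_dy).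
Hypotheses (L0 : 0 < L) (fL : smooth L f).
Hypotheses (fmu : strongly_convex_strongly_concave mu f) (fzs : saddle_point f zs).
Implicit Types (x u : 'rV[R]_dx) (y v : 'rV[R]_dy).

Lemma slope_x z u : slope f z (u, 0) = dot (gradx f z) u.
Proof. by rewrite /slope dot0r addr0. Qed.

Lemma slope_y z v : slope f z (0, v) = dot (grady f z) v.
Proof. by rewrite /slope dot0r add0r. Qed.

Lemma descent_x x y u :
  f (x + u, y) <= f (x, y) + dot (gradx f (x, y)) u + L / 2 * sq u.
Proof.
have := descent_le L f L0 fL (x, y) (u, 0).
by rewrite slope_x dot0r addr0 -[(x, y) + _]/(x + u, y + 0) addr0.
Qed.

Lemma descent_y x y v :
  f (x, y) + dot (grady f (x, y)) v - L / 2 * sq v <= f (x, y + v).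
Proof.
have := descent_ge L f L0 fL (x, y) (0, v).
by rewrite slope_y dot0r add0r -[(x, y) + _]/(x + 0, y + v) addr0.
Qed.

Lemma convex_x x y u :
  f (x, y) + dot (gradx f (x, y)) u + mu / 2 * sq u <= f (x + u, y).
Proof.
apply: (@strongly_convex_first_order _ _ mu _ (L / 2 * sq u) (fun x => f (x, y)) x u (fmu.1 y)).
move=> t _ _; have := descent_ge L f L0 fL (x, y) (t *: u, 0).
rewrite slope_x dot0r addr0 -[(x, y) + _]/(x + t *: u, y + 0) addr0 !dotE; lra.
Qed.

Lemma concave_y x y v :
  f (x, y + v) <= f (x, y) + dot (grady f (x, y)) v - mu / 2 * sq v.
Proof.
suff : - f (x, y) - dot (grady f (x, y)) v + mu / 2 * sq v <= - f (x, y + v) by lra.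
apply: (@strongly_convex_first_order _ _ mu _ (L / 2 * sq v) (fun y => - f (x, y)) y v (fmu.2 x)).
move=> t _ _; have := descent_le L f L0 fL (x, y) (0, t *: v).
rewrite slope_y dot0r add0r -[(x, y) + _]/(x + 0, y + t *: v) addr0 !dotE; lra.
Qed.

(** A gradient step of size 1/L from the saddle point would otherwise decrease f by at
    least |g|^2 / (2L), by the descent inequality. *)
Lemma gradx_saddle : gradx f zs = 0.
Proof.
apply: sq_le0; set g := gradx f zs.
have := descent_x zs.1 zs.2 (- L^-1 *: g).
have := (fzs (zs.1 + - L^-1 *: g) zs.2).2; rewrite -surjective_pairing -/g !dotE.
set s := dot g g => H1 H2.
have : L^-1 / 2 * s <= 0.
  have -> : L^-1 / 2 * s = - (- L^-1 * s + L / 2 * (- L^-1 * (- L^-1 * s))).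
    by field; rewrite gt_eqF.
  lra.
by rewrite pmulr_rle0// divr_gt0 ?invr_gt0.
Qed.

Lemma grady_saddle : grady f zs = 0.
Proof.
apply: sq_le0; set g := grady f zs.
have := descent_y zs.1 zs.2 (L^-1 *: g).
have := (fzs zs.1 (zs.2 + L^-1 *: g)).1; rewrite -surjective_pairing -/g !dotE.
set s := dot g g => H1 H2.
have : L^-1 / 2 * s <= 0.
  have -> : L^-1 / 2 * s = (L^-1 * s - L / 2 * (L^-1 * (L^-1 * s))).
    by field; rewrite gt_eqF.
  lra.
by rewrite pmulr_rle0// divr_gt0 ?invr_gt0.
Qed.

Lemma slope_saddle w : slope f zs w = 0.
Proof. by rewrite /slope gradx_saddle grady_saddle !dot0l addr0. Qed.

Lemma saddle_ge z :
  f zs - L / 2 * (sq (z.1 - zs.1) + sq (z.2 - zs.2)) <= f z.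
Proof.
have := descent_ge L f L0 fL zs (z - zs).
by rewrite slope_saddle addr0 [zs + _]addrC subrK.
Qed.

Lemma saddle_growth_x x : f zs + mu / 2 * sq (x - zs.1) <= f (x, zs.2).
Proof.
have := convex_x zs.1 zs.2 (x - zs.1).
by rewrite -surjective_pairing gradx_saddle dot0l addr0 [zs.1 + _]addrC subrK.
Qed.

Lemma saddle_growth_y y : f (zs.1, y) <= f zs - mu / 2 * sq (y - zs.2).
Proof.
have := concave_y zs.1 zs.2 (y - zs.2).
by rewrite -surjective_pairing grady_saddle dot0l addr0 [zs.2 + _]addrC subrK.
Qed.

(** Quadratic lower and upper bounds with constants mu and L force mu <= L,
    unless there is no nonzero vector at all, that is dx = dy = 0. *)
Lemma mu_le_L_or_degenerate : mu <= L \/ forall z, penorm (z - zs) ^+ 2 = 0.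
Proof.
have [|Lmu] := leP mu L; [by left | right => z].
rewrite penorm_sq.
have := convex_x zs.1 zs.2 (z.1 - zs.1); have := descent_x zs.1 zs.2 (z.1 - zs.1).
have := concave_y zs.1 zs.2 (z.2 - zs.2); have := descent_y zs.1 zs.2 (z.2 - zs.2).
have : 0 < (mu - L) / 2 by lra.
have := sq_ge0 (z.1 - zs.1); have := sq_ge0 (z.2 - zs.2).
rewrite -[(z - zs).1]/(z.1 - zs.1) -[(z - zs).2]/(z.2 - zs.2).
move: (sq (z.1 - zs.1)) (sq (z.2 - zs.2)) => s1 s2 p2 p1 d H1 H2 H3 H4.
have h1 : (mu - L) / 2 * s1 <= 0 by lra.
have h2 : (mu - L) / 2 * s2 <= 0 by lra.
move: h1 h2; rewrite !pmulr_rle0// => h1 h2; lra.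
Qed.

(** * Decrease of the energy along the iterates *)

Variable z : nat -> 'rV[R]_dx * 'rV[R]_dy.
Hypothesis zit : alt_gda_momentum f (1 / (5 * L)) (- (1 / 2)) z.
Hypotheses (mu0 : 0 <= mu) (muL : mu <= L).

Let tau := 1 / (5 * L) * mu.

Lemma tau_ge0 : 0 <= tau.
Proof. by rewrite mulr_ge0// divr_ge0// mulr_ge0// ltW. Qed.

Lemma muE : mu = 5 * L * tau.
Proof. by rewrite /tau; field; rewrite gt_eqF. Qed.

Lemma tau_le : tau <= 5^-1.
Proof. by rewrite -(ler_pM2l L0); have := muE; have := muL; lra. Qed.

(* errors (e), next displacements (p) and last displacements (q) *)
Let ex t := (z t).1 - zs.1.
Let ey t := (z t).2 - zs.2.
Let px t := (z t.+1).1 - (z t).1.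
Let py t := (z t.+1).2 - (z t).2.
Let qx t := (z t).1 - (z t.-1).1.
Let qy t := (z t).2 - (z t.-1).2.

Definition energy t : R :=
  L * (pot ((z t).1 - zs.1) ((z t).1 - (z t.-1).1) ((z t.-1).1 - (z t.-2).1)
     + pot ((z t).2 - zs.2) ((z t).2 - (z t.-1).2) ((z t.-1).2 - (z t.-2).2))
  - 9^-1 * (f (z t) - f zs).

Lemma gradx_step t :
  gradx f (z t) = - (5 * L) *: (px t + 2^-1 *: qx t).
Proof.
have := (zit t).1; rewrite -surjective_pairing => E.
apply/rowP => i; move/rowP/(_ i): E; rewrite /px /qx !mxE => ->.
by field; rewrite gt_eqF.
Qed.

Lemma grady_step t :
  grady f ((z t.+1).1, (z t).2) = (5 * L) *: (py t + 2^-1 *: qy t).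
Proof.
have := (zit t).2 => E.
apply/rowP => i; move/rowP/(_ i): E; rewrite /py /qy !mxE => ->.
by field; rewrite gt_eqF.
Qed.

(** Each inequality in the proof enters linearly, with the weights given in the
    opening comment; the lower bound on f at z_t is multiplied by tau, to
    compare the energy with 1 - tau times itself. *)
Lemma energy_step t :
  energy t.+1 <= (1 - tau) * energy t +
    L * (resid_x tau (ex t) (px t) (qx t) (qx t.-1) +
         resid_y tau (ey t) (py t) (qy t) (qy t.-1)).
Proof.
have ex1 : (z t.+1).1 - zs.1 = ex t + px t by rewrite /ex /px [RHS]addrC addrA subrK.
have ey1 : (z t.+1).2 - zs.2 = ey t + py t by rewrite /ey /py [RHS]addrC addrA subrK.
have zx1 : (z t).1 + px t = (z t.+1).1 by rewrite [LHS]addrC subrK.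
have zy1 : (z t).2 + py t = (z t.+1).2 by rewrite [LHS]addrC subrK.
have zx2 : (z t).1 + - ex t = zs.1 by rewrite /ex opprB [LHS]addrC subrK.
have zy2 : (z t).2 + - ey t = zs.2 by rewrite /ey opprB [LHS]addrC subrK.
have gx := gradx_step t; have gy := grady_step t.
have I1 := convex_x (z t).1 (z t).2 (- ex t).
have I2 := concave_y (z t.+1).1 (z t).2 (- ey t).
have I3 := saddle_growth_x (z t.+1).1.
have I4 := saddle_growth_y (z t).2.
have D1 := descent_x (z t).1 (z t).2 (px t).
have D2 := descent_y (z t.+1).1 (z t).2 (py t).
have S := saddle_ge (z t).
move: I1 I2 I3 I4 D1 D2 S.
rewrite zx1 zx2 zy1 zy2 -!surjective_pairing gx gy ex1 -/(ex t) -/(ey t).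
rewrite !(dotNl (ex t), dotNr (ex t), dotNl (ey t), dotNr (ey t)) !(dotZl (- (5 * L))) !(dotZl (5 * L)).
rewrite /energy ex1 ey1 -/(px t) -/(py t) -/(qx t) -/(qy t).
rewrite -/(qx t.-1) -/(qy t.-1) -/(ex t) -/(ey t).
rewrite /resid_x /resid_y muE.
have := tau_ge0.
move=> T I1 I2 I3 I4 D1 D2 S.
have {}S := ler_wpM2l T S.
lra.
Qed.

(** For t > 0 the squares of gradient differences in [resid_x_le] and
    [resid_y_le] are cancelled by the Lipschitz bounds between z_{t-1} and z_t
    and between w_{t-1} and w_t. *)
Lemma energy_decrease t : energy t.+1 <= (1 - tau) * energy t.
Proof.
apply: le_trans (energy_step t) _; rewrite gerDl.
rewrite pmulr_rle0//.
case: t => [|t].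
  have -> : qx 0 = 0 by rewrite /qx subrr.
  have -> : qy 0 = 0 by rewrite /qy subrr.
  have := resid_x_first tau (ex 0) (px 0) tau_ge0 tau_le.
  have := resid_y_first tau (ey 0) (py 0) tau_ge0 tau_le.
  lra.
rewrite [t.+1.-1]/=.
have := resid_x_le tau (ex t.+1) (px t.+1) (qx t.+1) (qx t) tau_ge0 tau_le.
have := resid_y_le tau (ey t.+1) (py t.+1) (qy t.+1) (qy t) tau_ge0 tau_le.
have := grad_lipschitz L f L0 fL (z t.+1) (z t).
have := grad_lipschitz L f L0 fL ((z t.+2).1, (z t.+1).2) ((z t.+1).1, (z t).2).
rewrite !gradx_step !grady_step /=.
have -> : - (5 * L) *: (px t.+1 + 2^-1 *: qx t.+1) - - (5 * L) *: (px t + 2^-1 *: qx t)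
  = - (5 * L) *: (px t.+1 - 2^-1 *: qx t.+1 - 2^-1 *: qx t).
  by apply/rowP => i; rewrite /px /qx !mxE/=; field.
have -> : (5 * L) *: (py t.+1 + 2^-1 *: qy t.+1) - (5 * L) *: (py t + 2^-1 *: qy t)
  = (5 * L) *: (py t.+1 - 2^-1 *: qy t.+1 - 2^-1 *: qy t).
  by apply/rowP => i; rewrite /py /qy !mxE/=; field.
set ux := px t.+1 - _ - _; set uy := py t.+1 - _ - _.
rewrite !(dotZl (- (5 * L))) !(dotZl (5 * L)) !(dotZr (- (5 * L))) !(dotZr (5 * L)).
rewrite -[(z t.+2).1 - _]/(px t.+1) -[(z t.+1).2 - _]/(qy t.+1) -[(z t.+1).1 - _]/(qx t.+1).
set g1 := gradx f _ - _; set g2 := grady f _ - _.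
have := sq_ge0 g1; have := sq_ge0 g2.
move=> p2 p1 H1 H2.
have L2 : 0 < L ^+ 2 by rewrite exprn_gt0.
have K1 : 25 * sq uy <= sq (px t.+1) + sq (qy t.+1).
  by rewrite -(ler_pM2l L2); lra.
have K2 : 25 * sq ux <= sq (qx t.+1) + sq (qy t.+1).
  by rewrite -(ler_pM2l L2); lra.
lra.
Qed.

Lemma linear_rate T :
  penorm (z T - zs) ^+ 2 <= 6 * (1 - tau) ^+ T * penorm (z 0%N - zs) ^+ 2.
Proof.
have tau1 : 0 <= 1 - tau by have := tau_le; lra.
have E : energy T <= (1 - tau) ^+ T * energy 0.
  elim: T => [|T IH]; first by rewrite expr0 mul1r.
  apply: le_trans (energy_decrease T) _.
  by rewrite exprS -mulrA ler_wpM2l.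
have := pot_ge (ex T) (qx T) (qx T.-1).
have := pot_ge (ey T) (qy T) (qy T.-1).
have U := descent_le L f L0 fL zs (z T - zs).
have := saddle_ge (z 0).
move: U; rewrite slope_saddle [zs + _]addrC subrK addr0.
rewrite !penorm_sq.
rewrite -[(z T - zs).1]/(ex T) -[(z T - zs).2]/(ey T).
rewrite -[(z 0%N - zs).1]/(ex 0) -[(z 0%N - zs).2]/(ey 0).
rewrite -[(z 0%N).1 - _]/(ex 0) -[(z 0%N).2 - _]/(ey 0).
have E0 : energy 0 = L * (sq (ex 0) + sq (ey 0)) - 9^-1 * (f (z 0%N) - f zs).
  by rewrite /energy /pot !subrr !scaler0 !subr0 !(dot0l, dot0r); lra.
move: E; rewrite {}E0 /energy -/(qx T) -/(qy T) -/(qx T.-1) -/(qy T.-1) -/(ex T) -/(ey T).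
set rho := _ ^+ T.
have rho0 : 0 <= rho by exact: exprn_ge0.
move: (sq (ex T)) (sq (ey T)) (sq (ex 0)) (sq (ey 0)) (pot _ _ _) (pot _ _ _).
move=> sx sy sx0 sy0 vx vy E U S0 Py Px.
rewrite -(ler_pM2l L0).
have {}S0 := ler_wpM2l rho0 S0.
have {}Px := ler_wpM2l (ltW L0) Px.
have {}Py := ler_wpM2l (ltW L0) Py.
lra.
Qed.

End Saddle.

(** * Iteration complexity *)

(** Since 1 - tau <= exp (- tau), the constant 20 gives (1 - tau)^T <= eps^4,
    and the spare factor eps^3 <= 1/8 compensates for the constant 6. *)
Lemma rate_le_eps (R : realType) (L mu eps : R) (T : nat) :
  0 < L -> 0 < mu -> mu <= L -> 0 < eps -> eps <= 1 / 2 ->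
  20 * (L / mu) * ln (1 / eps) <= T%:R ->
  6 * (1 - 1 / (5 * L) * mu) ^+ T <= eps.
Proof.
move=> L0 mu0 muL eps0 eps2 HT.
set tau := 1 / (5 * L) * mu.
have tau0 : 0 < tau by rewrite mulr_gt0// divr_gt0// mulr_gt0.
have muE : mu = 5 * L * tau by rewrite /tau; field; rewrite gt_eqF.
have tau1 : 0 <= 1 - tau by rewrite -(pmulr_rge0 _ L0); lra.
have HT4 : - (tau * T%:R) <= 4 * ln eps.
  move: HT; rewrite div1r lnV// => /(ler_wpM2l (ltW tau0)).
  suff -> : tau * (20 * (L / mu) * - ln eps) = - (4 * ln eps) by lra.
  by rewrite /tau; field; rewrite !gt_eqF.
have : (1 - tau) ^+ T <= eps ^+ 4.
  apply: (@le_trans _ _ (expR (- tau) ^+ T)).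
    by rewrite lerXn2r ?nnegrE ?expR_ge0// expR_ge1Dx.
  rewrite -expRM_natl mulrN mulrC.
  by rewrite -[eps in leRHS]lnK// -expRM_natl ler_expR.
have : eps ^+ 4 <= eps / 8.
  have : eps ^+ 3 <= (1 / 2) ^+ 3 by rewrite lerXn2r ?nnegrE// ltW.
  move=> /(ler_wpM2l (ltW eps0)); rewrite -exprS; lra.
lra.
Qed.

Theorem theorem3p2 (R : realType) :
  (forall (dx dy : nat) (L mu : R) (f : 'rV[R]_dx * 'rV[R]_dy -> R)
      (zs : 'rV[R]_dx * 'rV[R]_dy) (z : nat -> 'rV[R]_dx * 'rV[R]_dy),
    0 < L -> 0 <= mu ->
    smooth L f -> strongly_convex_strongly_concave mu f ->
    saddle_point f zs ->
    alt_gda_momentum f (1 / (5 * L)) (- (1 / 2)) z ->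
    forall T : nat,
      penorm (z T - zs) ^+ 2 <=
      6 * (1 - 1 / (5 * L) * mu) ^+ T * penorm (z 0%N - zs) ^+ 2)
  /\
  (exists C : R, 0 < C /\
    forall (dx dy : nat) (L mu : R) (f : 'rV[R]_dx * 'rV[R]_dy -> R)
      (zs : 'rV[R]_dx * 'rV[R]_dy) (z : nat -> 'rV[R]_dx * 'rV[R]_dy),
    0 < L -> 0 < mu ->
    smooth L f -> strongly_convex_strongly_concave mu f ->
    saddle_point f zs ->
    alt_gda_momentum f (1 / (5 * L)) (- (1 / 2)) z ->
    forall (eps : R) (T : nat),
      0 < eps -> eps <= 1 / 2 ->
      C * (L / mu) * ln (1 / eps) <= T%:R ->
      penorm (z T - zs) ^+ 2 <= eps * penorm (z 0%N - zs) ^+ 2).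
Proof.
split=> [dx dy L mu f zs z L0 mu0 fL fmu fzs zit T|].
  have [muL|deg] := @mu_le_L_or_degenerate _ _ _ L mu f zs L0 fL fmu.
    exact: (@linear_rate _ _ _ L mu f zs L0 fL fmu fzs z zit mu0 muL T).
  by rewrite !deg mulr0.
exists 20; split=> // dx dy L mu f zs z L0 mu0 fL fmu fzs zit eps T eps0 eps2 HT.
have [muL|deg] := @mu_le_L_or_degenerate _ _ _ L mu f zs L0 fL fmu; last first.
  by rewrite !deg mulr0.
apply: le_trans (@linear_rate _ _ _ L mu f zs L0 fL fmu fzs z zit (ltW mu0) muL T) _.
apply: ler_wpM2r; first exact: sqr_ge0.
exact: rate_le_eps HT.
Qed.
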